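(* Let $X$ be a $T_1$ topological space. The following statements are equivalent: (1) $X$ is $\omega_1$-resolvable in some c.c.c. generic extension (i.e. there is a c.c.c. poset $\mathbb P$ such that $V^{\mathbb P}\models$ ''$X$ is $\omega_1$-resolvable''); (2) $X$ is monotonically $\omega_1$-resolvable; (3) $X$ is $\omega_1$-resolvable in the Cohen generic extension $V^{\mathrm{Fn}(\omega_1,2)}$.
   Context: A topological space is $\kappa$-resolvable if it can be partitioned into $\kappa$ many dense subspaces. For an infinite cardinal $\kappa$, a topological space $X$ is monotonically $\kappa$-resolvable if there is a function $f:X\to\kappa$ such that $\{x\in X: f(x)\ge\alpha\}$ is dense in $X$ for each $\alpha<\kappa$. $V$ is the ground model. $\mathrm{Fn}(I,J)$ is the poset of finite partial functions from $I$ to $J$ ordered by reverse inclusion. If $X$ is a ground-model space with topology $\tau_X$, then in a generic extension $X$ is regarded as the topological space on the same underlying set whose topology has base $\tau_X$; ''$X$ has a property in $V^{\mathbb P}$'' means that this is forced by $\mathbb P$. *)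

(* Defs.v *)
From HB Require Import structures.
From mathcomp Require Import all_boot all_order finmap.
From mathcomp Require Import all_classical wochoice topology separation_axioms.

Set Implicit Arguments.
Unset Strict Implicit.
Unset Printing Implicit Defensive.

Import Order.TTheory.

Local Open Scope classical_set_scope.
Local Open Scope order_scope.

(** * The cardinal omega_1 *)

(* A fixed well-order of the uncountable type [nat -> bool]. *)
Definition wo_le : rel (nat -> bool) :=
  sval (well_ordering_principle (nat -> bool)).

Lemma wo_leP : well_order wo_le.
Proof. exact: svalP (well_ordering_principle (nat -> bool)). Qed.

(* The points with countably many predecessors form an initial segment of
   [wo_le]; its order type is omega_1 (lemmas [omega1_wf],
   [omega1_initial_countable] and [omega1_uncountable] below). *)
Definition omega1 : Type :=
  {x : nat -> bool | `[< countable [set y | wo_le y x] >]}.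

HB.instance Definition _ := Choice.on omega1.

Fact omega1_display : Order.disp_t. Proof. exact: (Order.Disp tt tt). Qed.

Definition omega1_le : rel omega1 := fun x y => wo_le (val x) (val y).

Lemma wo_le_chain : wo_chain wo_le predT.
Proof. by move=> A _; apply: wo_leP. Qed.

Lemma wo_le_trans : transitive wo_le.
Proof.
move=> y x z xy yz.
have tot a b : wo_le a b || wo_le b a by exact: (wo_chainW wo_le_chain).
have anti a b : wo_le a b && wo_le b a -> a = b.
  by move=> ab; apply: (wo_chain_antisymmetric wo_le_chain).
have [|m [[mA mmin] _]] := wo_leP (A := [pred t | [|| t == x, t == y | t == z]]).
  by exists x; rewrite inE eqxx.
have mx : wo_le m x by apply: mmin; rewrite inE eqxx.
have my : wo_le m y by apply: mmin; rewrite inE eqxx orbT.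
have mz : wo_le m z by apply: mmin; rewrite inE eqxx !orbT.
move: mA; rewrite inE => /or3P[] /eqP mE; subst m => //.
  by rewrite (anti x y) ?xy ?my.
have zy : y = z by apply: anti; rewrite yz my.
by rewrite -zy.
Qed.

Lemma omega1_le_refl : reflexive omega1_le.
Proof. by move=> x; apply: (wo_chain_reflexive wo_le_chain). Qed.

Lemma omega1_le_anti : antisymmetric omega1_le.
Proof.
by move=> x y xy; apply: val_inj; apply: (wo_chain_antisymmetric wo_le_chain).
Qed.

Lemma omega1_le_trans : transitive omega1_le.
Proof. by move=> y x z; apply: wo_le_trans. Qed.

Lemma omega1_le_total : total omega1_le.
Proof. by move=> x y; apply: (wo_chainW wo_le_chain). Qed.

HB.instance Definition _ := Order.Le_isPOrder.Build omega1_display omega1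
  omega1_le_refl omega1_le_anti omega1_le_trans.
HB.instance Definition _ :=
  Order.POrder_isTotal.Build omega1_display omega1 omega1_le_total.

Lemma omega1_wf (A : set omega1) :
  A !=set0 -> exists2 m, A m & forall x, A x -> m <= x.
Proof.
move=> [a Aa].
have [|m [[+ mmin] _]] :=
    wo_leP (A := [pred t | `[< exists2 x, A x & val x = t >]]).
  by exists (val a); rewrite inE; exists a.
rewrite inE => -[x Ax xm]; exists x => // y Ay.
rewrite /Order.le /= /omega1_le xm; apply: mmin.
by rewrite inE; exists y.
Qed.

Lemma omega1_initial_countable (x : omega1) : countable [set y | y <= x].
Proof.
have /asboolP/countable_injP[g gi] := valP x.
apply/countable_injP; exists (g \o val) => y z /set_mem yx /set_mem zx gyz.
by apply/val_inj/gi => //; rewrite inE.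
Qed.

Lemma omega1_uncountable : ~ countable [set: omega1].
Proof.
move=> ct.
pose W : set (nat -> bool) := [set x | countable [set y | wo_le y x]].
have WC : countable W.
  apply: (sub_countable _ ct); apply: card_le_trans (card_image_le val setT).
  apply: subset_card_le => x Wx; have Wx' : `[< W x >] by exact/asboolP.
  by exists (exist _ x Wx').
have /countable_injP[g gi] := WC.
have Wall x : W x.
  apply: contrapT => nWx.
  have [|m [[+ mmin] _]] := wo_leP (A := [pred t | ~~ `[< W t >]]).
    by exists x; rewrite !inE; apply/asboolP.
  rewrite inE => /asboolP; apply; apply/countable_injP.
  have W' y : wo_le y m -> y != m -> W y.
    move=> ym /eqP nym; apply: contrapT => nWy; apply: nym.
    apply: (wo_chain_antisymmetric wo_le_chain) => //.
    by rewrite ym mmin // inE; apply/asboolP.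
  exists (fun y => if y == m then 0%N else (g y).+1) => y z.
  move=> /set_mem ym /set_mem zm; case: eqP => [->|/eqP ny].
    by case: eqP.
  case: eqP => // /eqP nz [gyz].
  by apply: gi; rewrite ?inE //; apply: W'.
pose h (n : nat) : bool := `[< exists2 x, g x = n & ~~ x n >].
have [H|H] := boolP (h (g h)).
  have /asboolP[x gx] := H.
  by rewrite (gi x h (mem_set (Wall x)) (mem_set (Wall h)) gx) H.
by have /asboolP[] := H; exists h.
Qed.

(** * Spaces *)

(* The infinite cardinal kappa is given as an ordered type [K] whose order type
   is that of kappa. *)
Definition monotonically_resolvable {d : Order.disp_t} (K : orderType d)
    (X : topologicalType) : Prop :=
  exists f : X -> K, forall a : K, dense [set x | a <= f x].

(** * Forcing notions *)

Definition compatible {d : Order.disp_t} {P : porderType d} (p q : P) : Prop :=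
  exists r : P, r <= p /\ r <= q.

Definition antichain {d : Order.disp_t} {P : porderType d} (A : set P) : Prop :=
  forall p q : P, A p -> A q -> p <> q -> ~ compatible p q.

Definition ccc {d : Order.disp_t} (P : porderType d) : Prop :=
  forall A : set P, antichain A -> countable A.

Definition Fn (I J : choiceType) : Type := {fmap I -> J}.

Fact Fn_display : Order.disp_t. Proof. exact: (Order.Disp tt tt). Qed.

Section FnOrder.
Variables I J : choiceType.

HB.instance Definition _ := Choice.on (Fn I J).

Definition Fn_le : rel (Fn I J) := fun f g : {fmap I -> J} =>
  `[< forall (i : I) (j : J), g.[? i]%fmap = Some j -> f.[? i]%fmap = Some j >].

Lemma Fn_le_refl : reflexive Fn_le.
Proof. by move=> f; apply/asboolP. Qed.

Lemma Fn_le_anti : antisymmetric Fn_le.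
Proof.
move=> f g /andP[/asboolP fg /asboolP gf]; apply/fmapP => i.
case fi: (f.[? i])%fmap => [j|]; first by rewrite (gf _ _ fi).
by case gi: (g.[? i])%fmap => [j|//]; rewrite -fi (fg _ _ gi).
Qed.

Lemma Fn_le_trans : transitive Fn_le.
Proof.
move=> g f h /asboolP fg /asboolP gh; apply/asboolP => i j hij.
exact/fg/gh.
Qed.

HB.instance Definition _ := Order.Le_isPOrder.Build Fn_display (Fn I J)
  Fn_le_refl Fn_le_anti Fn_le_trans.

End FnOrder.

(** * The language of set theory *)

(* Formulas with parameters in [M]; bound variables are higher-order. *)
Inductive formula (M : Type) : Type :=
| FEq of M & M
| FMem of M & M
| FNot of formula M
| FAnd of formula M & formula M
| FAll of (M -> formula M).

Declare Scope zf_scope.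
Delimit Scope zf_scope with zf.
Bind Scope zf_scope with formula.

Notation "a ≐ b" := (FEq a b) (at level 70, no associativity) : zf_scope.
Notation "a ∈ b" := (FMem a b) (at level 70, no associativity) : zf_scope.
Notation "¬ φ" := (FNot φ) (at level 75, right associativity) : zf_scope.
Notation "φ ∧ ψ" := (FAnd φ ψ) (at level 80, right associativity) : zf_scope.
Notation "φ ∨ ψ" := (FNot (FAnd (FNot φ) (FNot ψ)))
  (at level 85, right associativity) : zf_scope.
Notation "φ ⇒ ψ" := (FNot (FAnd φ (FNot ψ)))
  (at level 90, ψ at level 200, right associativity) : zf_scope.
Notation "φ ⇔ ψ" := (FAnd (FNot (FAnd φ (FNot ψ))) (FNot (FAnd ψ (FNot φ))))
  (at level 95, no associativity) : zf_scope.
Notation "∀ x .. y , φ" := (FAll (fun x => .. (FAll (fun y => φ)) ..))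
  (at level 200, x binder, y binder, right associativity) : zf_scope.
Notation "∃ x .. y , φ" :=
  (FNot (FAll (fun x => FNot .. (FNot (FAll (fun y => FNot φ))) ..)))
  (at level 200, x binder, y binder, right associativity) : zf_scope.

Section SetTheory.
Context {M : Type}.
Implicit Types a b c f n p w x y z A B I O S T U X κ τ α β : M.
Local Open Scope zf_scope.

Definition zf_sub A B : formula M := ∀ x, x ∈ A ⇒ x ∈ B.
Definition zf_nonempty A : formula M := ∃ x, x ∈ A.

(* b = a ∪ {a} *)
Definition zf_succ a b : formula M := ∀ x, x ∈ b ⇔ (x ∈ a ∨ x ≐ a).

(* p = {a, b} *)
Definition zf_upair a b p : formula M := ∀ x, x ∈ p ⇔ (x ≐ a ∨ x ≐ b).

(* p = (a, b) = {{a}, {a, b}} *)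
Definition zf_pair a b p : formula M :=
  ∃ c d, zf_upair a a c ∧ zf_upair a b d ∧ zf_upair c d p.

(* (a, b) ∈ f *)
Definition zf_maps f a b : formula M := ∃ p, zf_pair a b p ∧ p ∈ f.

Definition zf_function f A : formula M :=
  (∀ p, p ∈ f ⇒ ∃ a b, a ∈ A ∧ zf_pair a b p) ∧
  (∀ a, a ∈ A ⇒ ∃ b, zf_maps f a b ∧ ∀ c, zf_maps f a c ⇒ c ≐ b).

Definition zf_injection f A B : formula M :=
  zf_function f A ∧
  (∀ a b, zf_maps f a b ⇒ b ∈ B) ∧
  (∀ a b c, zf_maps f a c ∧ zf_maps f b c ⇒ a ≐ b).

Definition zf_inductive I : formula M :=
  (∃ z, ¬ zf_nonempty z ∧ z ∈ I) ∧
  (∀ n, n ∈ I ⇒ ∃ m, zf_succ n m ∧ m ∈ I).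

(* w = ω, the least inductive set *)
Definition zf_omega w : formula M :=
  zf_inductive w ∧ ∀ I, zf_inductive I ⇒ zf_sub w I.

Definition zf_countable A : formula M :=
  ∃ w f, zf_omega w ∧ zf_injection f A w.

(* transitive and strictly well-ordered by ∈ *)
Definition zf_ordinal a : formula M :=
  (∀ x, x ∈ a ⇒ zf_sub x a) ∧
  (∀ x, x ∈ a ⇒ ¬ x ∈ x) ∧
  (∀ x y z, x ∈ a ∧ y ∈ a ∧ z ∈ a ∧ x ∈ y ∧ y ∈ z ⇒ x ∈ z) ∧
  (∀ x y, x ∈ a ∧ y ∈ a ⇒ x ∈ y ∨ x ≐ y ∨ y ∈ x) ∧
  (∀ S, zf_sub S a ∧ zf_nonempty S ⇒
     ∃ m, m ∈ S ∧ ∀ x, x ∈ S ⇒ m ≐ x ∨ m ∈ x).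

(* κ = ω₁, the least uncountable ordinal *)
Definition zf_omega1 κ : formula M :=
  zf_ordinal κ ∧ ¬ zf_countable κ ∧ ∀ α, α ∈ κ ⇒ zf_countable α.

(* O is open in the topology on X that has base τ *)
Definition zf_open X τ O : formula M :=
  zf_sub O X ∧ ∀ x, x ∈ O ⇒ ∃ U, U ∈ τ ∧ x ∈ U ∧ zf_sub U O.

Definition zf_dense X τ S : formula M :=
  zf_sub S X ∧
  ∀ O, zf_open X τ O ∧ zf_nonempty O ⇒ ∃ x, x ∈ O ∧ x ∈ S.

(* X, with base τ, is partitioned by a κ-indexed family D of dense subsets.
   Distinct indices are required to have disjoint values; only for X = ∅ does
   this allow two values to coincide. *)
Definition zf_resolvable κ X τ : formula M :=
  ∃ D, zf_function D κ ∧
    (∀ α S, zf_maps D α S ⇒ zf_dense X τ S) ∧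
    (∀ x, x ∈ X ⇒ ∃ α S, zf_maps D α S ∧ x ∈ S) ∧
    (∀ α β S T x,
       zf_maps D α S ∧ zf_maps D β T ∧ x ∈ S ∧ x ∈ T ⇒ α ≐ β).

Definition zf_omega1_resolvable X τ : formula M :=
  ∃ κ, zf_omega1 κ ∧ zf_resolvable κ X τ.

End SetTheory.

(** * The ground model *)

(* Aczel's sets: [VSet I f] is the set {f i | i : I}. They play the role of V. *)
Inductive vset : Type := VSet (I : Type) of (I -> vset).
Arguments VSet : clear implicits.

(* Extensional equality of sets *)
Fixpoint vset_eq (a b : vset) : Prop :=
  match a, b with
  | VSet A f, VSet B g =>
      (forall i, exists j, vset_eq (f i) (g j)) /\
      (forall j, exists i, vset_eq (f i) (g j))
  end.

(* The points of a ground-model space are sets: they are given by a map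
   [e : X -> vset] that is injective up to [vset_eq]. Such a map exists for
   every type (lemma [vset_coding_exists]). *)
Definition vset_coding {X : Type} (e : X -> vset) : Prop :=
  forall x y, vset_eq (e x) (e y) -> x = y.

Lemma vset_eq_sym (a b : vset) : vset_eq a b -> vset_eq b a.
Proof.
elim: a b => [A f IH] [B g] /= [fg gf]; split=> i.
  by have [j ij] := gf i; exists j; apply: IH.
by have [j ij] := fg i; exists j; apply: IH.
Qed.

Lemma vset_coding_exists (X : eqType) : exists e : X -> vset, vset_coding e.
Proof.
have [R Rwo] := well_ordering_principle X.
have Rch : wo_chain R predT by move=> A _; apply: Rwo.
pose lt x y := x <> y /\ R x y.
have ltwf : well_founded lt.
  move=> x; apply: contrapT => nx.
  have [|m [[+ mmin] _]] := Rwo [pred t | ~~ `[< Acc lt t >]].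
    by exists x; rewrite !inE; apply/asboolP.
  rewrite inE => /asboolP; apply; constructor=> y [ym Rym].
  apply: contrapT => ny; apply: ym.
  apply: (wo_chain_antisymmetric Rch) => //; rewrite Rym mmin //.
  by rewrite !inE; apply/asboolP.
pose F x (rec : forall y, lt y x -> vset) : vset :=
  VSet {y | lt y x} (fun u => rec (sval u) (svalP u)).
pose e := Fix ltwf (fun=> vset) F.
have eE x : e x = VSet {y | lt y x} (fun u => e (sval u)).
  rewrite /e Fix_eq // => z f g fg; congr VSet.
  by apply: funext => u; apply: fg.
have eN x y : lt y x -> ~ vset_eq (e x) (e y).
  elim: (ltwf x) y => {}x _ IH y yx; rewrite (eE x) (eE y) /= => -[xy _].
  have [[z zy] /=] := xy (exist _ y yx); exact: IH.
exists e => x y exy; apply: contrapT => nxy.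
have /orP[Rxy|Ryx] := wo_chainW Rch (x := x) (y := y) isT isT.
  by apply: (eN y x); [split | apply: vset_eq_sym].
by apply: (eN x y); [split=> // yx; apply: nxy | ].
Qed.

Definition vset_image {X : Type} (e : X -> vset) (A : set X) : vset :=
  VSet _ (fun x : {x : X | A x} => e (sval x)).

Definition vset_topology {X : topologicalType} (e : X -> vset) : vset :=
  VSet _ (fun U : {U : set X | open U} => vset_image e (sval U)).

(** * Names and the forcing relation *)

Section Forcing.
Context {d : Order.disp_t} (P : porderType d).
Implicit Types p q r s : P.

(* [Name I x s] is the name {(x i, s i) | i : I}. *)
Inductive name : Type := Name (I : Type) of (I -> name) & (I -> P).
Arguments Name : clear implicits.

(* The canonical name {(check x, p) | x ∈ a, p ∈ P} of a ground-model set a *)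
Fixpoint check (a : vset) : name :=
  let: VSet A f := a in
  Name (A * P) (fun u => check (f u.1)) (fun u => u.2).

(* p ⊩ a = b if, whenever (x, s) ∈ a, the conditions r forcing x = y for some
   (y, t) ∈ b with r ≤ t are dense below every q ≤ p, s, and symmetrically. *)
Fixpoint forces_eq (a b : name) (p : P) {struct a} : Prop :=
  match a, b with
  | Name A x s, Name B y t =>
      (forall i q, q <= p -> q <= s i ->
         exists r, r <= q /\ exists j, r <= t j /\ forces_eq (x i) (y j) r) /\
      (forall j q, q <= p -> q <= t j ->
         exists r, r <= q /\ exists i, r <= s i /\ forces_eq (x i) (y j) r)
  end.

Definition forces_mem (a b : name) (p : P) : Prop :=
  let: Name B y t := b in
  forall q, q <= p ->
    exists r, r <= q /\ exists j, r <= t j /\ forces_eq a (y j) r.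

Fixpoint forces (p : P) (φ : formula name) : Prop :=
  match φ with
  | FEq a b => forces_eq a b p
  | FMem a b => forces_mem a b p
  | FNot ψ => forall q, q <= p -> ~ forces q ψ
  | FAnd ψ χ => forces p ψ /\ forces p χ
  | FAll ψ => forall a : name, forces p (ψ a)
  end.

(* V^P ⊨ φ *)
Definition forced (φ : formula name) : Prop := forall p : P, forces p φ.

(* V^P ⊨ "X is omega_1-resolvable", where omega_1 is that of the extension *)
Definition forces_omega1_resolvable {X : topologicalType} (e : X -> vset) :=
  forced (zf_omega1_resolvable (check (vset_image e [set: X]))
                               (check (vset_topology e))).

End Forcing.

(* Main.v *)
(** A monotone function [f] for [X] yields a partition in the Cohen extension:
    enumerate every ordinal [a <= f x] by [nat], and let the Cohen bits placed at
    [f x], [nxt (f x)], [nxt (nxt (f x))], ... select the index of [x]. A condition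
    has finite support, so every open set contains a point [x] with [f x] above the
    support, and the index of that point can still be chosen at will. The ordinal
    omega_1 is preserved because [Fn omega1 bool] is c.c.c.

    Conversely, let a condition [p] of a c.c.c. poset force that [D] is a partition
    into dense sets indexed by the omega_1 of the extension, which contains every
    ground-model countable ordinal. The set of the [a] such that some [q <= p]
    forces [x] into [D a] is countable, for these conditions [q] are pairwise
    incompatible. Hence it has a bound [f x], and [f] is monotone: given [a] and an
    open [U], some [q <= p] forces some [x] in [U] into [D a], so [a <= f x]. *)

Require Import Defs.
From mathcomp Require Import all_boot all_order finmap.
From mathcomp Require Import all_classical topology separation_axioms.

Set Implicit Arguments.
Unset Strict Implicit.
Unset Printing Implicit Defensive.

Import Order.TTheory.

Local Open Scope classical_set_scope.
Local Open Scope order_scope.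

Arguments forces : simpl never.
Arguments check {d} P a.

Local Notation "p ⊩ φ" := (forces p φ%zf) (at level 70, φ at level 60).

(** * The forcing relation *)

Section ForcingRelation.
Context {d : Order.disp_t} {P : porderType d}.
Implicit Types (p q r : P) (a b c x y z : name P) (φ ψ χ : formula (name P)).

Lemma forces_eqE p (a b : name P) : (p ⊩ (a ≐ b)) = forces_eq a b p.
Proof. by []. Qed.

Lemma forces_eq_le a b p q : q <= p -> forces_eq a b p -> forces_eq a b q.
Proof.
move=> qp; case: a b => [A x s] [B y t] /= [H1 H2].
by split=> i r rq; [apply: H1 | apply: H2]; apply: le_trans qp.
Qed.

Lemma forces_eq_dense a b p :
  (forall q, q <= p -> exists2 r, r <= q & forces_eq a b r) -> forces_eq a b p.
Proof.
case: a b => [A x s] [B y t] H; split=> i q qp qs.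
- have [r rq /= [H1 _]] := H q qp.
  have [r' [r'r ?]] := H1 i r (lexx r) (le_trans rq qs).
  by exists r'; split=> //; apply: le_trans rq.
- have [r rq /= [_ H1]] := H q qp.
  have [r' [r'r ?]] := H1 i r (lexx r) (le_trans rq qs).
  by exists r'; split=> //; apply: le_trans rq.
Qed.

Lemma forces_mem_le a b p q : q <= p -> forces_mem a b p -> forces_mem a b q.
Proof. by move=> qp; case: b => [B y t] /= H r rq; apply/H/(le_trans rq). Qed.

Lemma forces_mem_dense a b p :
  (forall q, q <= p -> exists2 r, r <= q & forces_mem a b r) -> forces_mem a b p.
Proof.
case: b => [B y t] H q qp; have [r rq /= H1] := H q qp.
have [r' [r'r ?]] := H1 r (lexx r).
by exists r'; split=> //; apply: le_trans rq.
Qed.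

Lemma forces_le p q φ : q <= p -> p ⊩ φ -> q ⊩ φ.
Proof.
move=> qp; elim: φ => [a b|a b|φ _|φ IH1 ψ IH2|φ IH].
- exact: forces_eq_le.
- exact: forces_mem_le.
- by move=> H r rq; apply/H/(le_trans rq).
- by move=> [H1 H2]; split; [apply: IH1|apply: IH2].
- by move=> H a; apply/IH/H.
Qed.

(** The atomic clauses and negation are density statements, and conjunction and [FAll] inherit the
    property. This makes the proof rules below possible: a forced formula may be proved after
    strengthening the condition. *)
Lemma forces_dense p φ :
  (forall q, q <= p -> exists2 r, r <= q & r ⊩ φ) -> p ⊩ φ.
Proof.
elim: φ => [a b|a b|φ _|φ IH1 ψ IH2|φ IH] H.
- exact: forces_eq_dense.
- exact: forces_mem_dense.
- move=> q qp qφ; have [r rq rN] := H q qp.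
  exact: (rN r (lexx r) (forces_le rq qφ)).
- by split; [apply: IH1|apply: IH2] => q /H[r rq []]; exists r.
- by move=> a; apply: IH => q /H[r rq]; exists r.
Qed.

Lemma forces_not p φ : p ⊩ (¬ φ) <-> forall q, q <= p -> q ⊩ φ -> False.
Proof. by []. Qed.

Lemma forces_and p φ ψ : p ⊩ (φ ∧ ψ) <-> p ⊩ φ /\ p ⊩ ψ.
Proof. by []. Qed.

Lemma forces_all p (φ : name P -> formula (name P)) :
  p ⊩ (FAll φ) <-> forall a, p ⊩ (φ a).
Proof. by []. Qed.

(** If no extension of [p] forced the negation, the conditions forcing [φ] would be dense below [p],
    and [forces_dense] would apply. *)
Lemma not_forces p φ : ~ p ⊩ φ -> exists2 q, q <= p & q ⊩ (¬ φ).
Proof.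
move=> H; apply: contrapT => N; apply: H; apply: forces_dense => q qp.
apply: contrapT => N'; apply: N; exists q => // r rq rφ.
by apply: N'; exists r.
Qed.

Lemma forces_imp p φ ψ :
  p ⊩ (φ ⇒ ψ) <-> forall q, q <= p -> q ⊩ φ -> q ⊩ ψ.
Proof.
split=> [H q qp qφ|H q qp [qφ qψ]].
- apply: contrapT => /not_forces[r rq rψ].
  by apply: (H r (le_trans rq qp)); split=> //; apply: forces_le qφ.
- exact: (qψ q (lexx q) (H q qp qφ)).
Qed.

Lemma forces_all_imp p (φ ψ : name P -> formula (name P)) :
  p ⊩ (∀ x, φ x ⇒ ψ x) <->
  forall x q, q <= p -> q ⊩ (φ x) -> q ⊩ (ψ x).
Proof.
split=> H x; last exact/forces_imp/H.
by have /forces_imp := (forces_all _ _).1 H x.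
Qed.

Lemma forces_iff p φ ψ :
  p ⊩ (φ ⇔ ψ) <-> forall q, q <= p -> (q ⊩ φ <-> q ⊩ ψ).
Proof.
split=> [/forces_and[/forces_imp H1 /forces_imp H2] q qp|H].
  by split; [apply: H1|apply: H2].
by apply/forces_and; split; apply/forces_imp => q /H[].
Qed.

Lemma forces_all_iff p (φ ψ : name P -> formula (name P)) :
  p ⊩ (∀ x, φ x ⇔ ψ x) <->
  forall x q, q <= p -> (q ⊩ (φ x) <-> q ⊩ (ψ x)).
Proof.
split=> H x; last exact/forces_iff/H.
by have /forces_iff := (forces_all _ _).1 H x.
Qed.

Lemma forces_or p φ ψ :
  p ⊩ (φ ∨ ψ) <-> forall q, q <= p -> exists2 r, r <= q & r ⊩ φ \/ r ⊩ ψ.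
Proof.
split=> [H q qp|H q qp [N1 N2]].
- apply: contrapT => N; apply: (H q qp); split=> r rq rφ; apply: N; exists r => //.
    by left.
  by right.
- by have [r rq []] := H q qp; [apply: N1|apply: N2].
Qed.

Lemma forces_ex p (φ : name P -> formula (name P)) :
  p ⊩ (FNot (FAll (fun x => FNot (φ x)))) <->
  forall q, q <= p -> exists2 r, r <= q & exists a, r ⊩ (φ a).
Proof.
split=> [H q qp|H q qp N].
- apply: contrapT => N; apply: (H q qp) => a r rq rφ.
  by apply: N; exists r => //; exists a.
- by have [r rq [a ra]] := H q qp; apply: (N a r rq).
Qed.

Lemma forces_exI p (φ : name P -> formula (name P)) a :
  p ⊩ (φ a) -> p ⊩ (FNot (FAll (fun x => FNot (φ x)))).
Proof.
move=> H; apply/forces_ex => q qp; exists q => //; exists a.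
exact: forces_le H.
Qed.

(** Witnesses exist only at extensions of [p], so elimination is possible when the goal is itself a
    forced formula. *)
Lemma forces_exE p (φ : name P -> formula (name P)) ψ :
  p ⊩ (FNot (FAll (fun x => FNot (φ x)))) ->
  (forall q a, q <= p -> q ⊩ (φ a) -> q ⊩ ψ) -> p ⊩ ψ.
Proof.
move=> /forces_ex H K; apply: forces_dense => q qp.
by have [r rq [a ra]] := H q qp; exists r => //; apply: K ra; apply: le_trans qp.
Qed.

Lemma forces_orE p φ ψ χ : p ⊩ (φ ∨ ψ) ->
  (forall q, q <= p -> q ⊩ φ -> q ⊩ χ) ->
  (forall q, q <= p -> q ⊩ ψ -> q ⊩ χ) -> p ⊩ χ.
Proof.
move=> /forces_or H K1 K2; apply: forces_dense => q qp.
have [r rq rφψ] := H q qp; exists r => //.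
by case: rφψ; [apply: K1|apply: K2]; apply: le_trans qp.
Qed.

Lemma forces_orl p φ ψ : p ⊩ φ -> p ⊩ (φ ∨ ψ).
Proof.
move=> H; apply/forces_or => q qp; exists q => //; left; exact: forces_le H.
Qed.

Lemma forces_orr p φ ψ : p ⊩ ψ -> p ⊩ (φ ∨ ψ).
Proof.
move=> H; apply/forces_or => q qp; exists q => //; right; exact: forces_le H.
Qed.

(** Excluded middle in the extension: the conditions that decide [φ] are dense. *)
Lemma forces_case φ p χ :
  (forall q, q <= p -> q ⊩ φ -> q ⊩ χ) ->
  (forall q, q <= p -> q ⊩ (¬ φ) -> q ⊩ χ) -> p ⊩ χ.
Proof.
move=> K1 K2; apply: forces_dense => q qp.
have [qφ|/not_forces[r rq rφ]] := EM (q ⊩ φ); first by exists q => //; exact: K1.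
by exists r => //; apply: K2 rφ; apply: le_trans qp.
Qed.

Lemma forces_absurd p φ ψ : p ⊩ φ -> p ⊩ (¬ φ) -> p ⊩ ψ.
Proof. by move=> H /(_ p (lexx p)). Qed.

Lemma forces_eq_refl a p : p ⊩ (a ≐ a).
Proof.
rewrite forces_eqE; elim: a p => [A x IH s] p /=.
by split=> i q qp qs; exists q; split=> //; exists i.
Qed.

Lemma forces_eq_sym a b p : p ⊩ (a ≐ b) -> p ⊩ (b ≐ a).
Proof.
rewrite !forces_eqE; elim: a b p => [A x IH s] [B y t] p /= [H1 H2].
split=> i q qp qs.
- by have [r [rq [j [rj ?]]]] := H2 i q qp qs; exists r; split=> //; exists j;
    split=> //; apply: IH.
- by have [r [rq [j [rj ?]]]] := H1 i q qp qs; exists r; split=> //; exists j;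
    split=> //; apply: IH.
Qed.

Lemma forces_eq_trans b a c p : p ⊩ (a ≐ b) -> p ⊩ (b ≐ c) -> p ⊩ (a ≐ c).
Proof.
rewrite !forces_eqE.
elim: a b c p => [A x IH s] [B y t] [C z u] p /= [H1 H2] [K1 K2].
split=> i q qp qs.
- have [r [rq [j [rj xy]]]] := H1 i q qp qs.
  have [r' [rr' [k [rk yz]]]] := K1 j r (le_trans rq qp) rj.
  exists r'; split; first exact: le_trans rq.
  by exists k; split=> //; apply: IH yz; apply: forces_eq_le xy.
- have [r [rq [j [rj yz]]]] := K2 i q qp qs.
  have [r' [rr' [k [rk xy]]]] := H2 j r (le_trans rq qp) rj.
  exists r'; split; first exact: le_trans rq.
  by exists k; split=> //; apply: (IH _ _ _ _ xy); apply: forces_eq_le yz.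
Qed.

Lemma forces_mem_eql a b c p : p ⊩ (a ≐ b) -> p ⊩ (a ∈ c) -> p ⊩ (b ∈ c).
Proof.
case: c => [C z u] ab H q qp; have [r [rq [k [rk az]]]] := H q qp.
exists r; split=> //; exists k; split=> //.
apply: (@forces_eq_trans a) az; apply: forces_eq_sym.
exact: forces_le (le_trans rq qp) ab.
Qed.

Lemma forces_mem_eqr a b c p : p ⊩ (b ≐ c) -> p ⊩ (a ∈ b) -> p ⊩ (a ∈ c).
Proof.
case: b c => [B y t] [C z u] [H _] ab q qp.
have [r [rq [j [rj ay]]]] := ab q qp.
have [r' [rr' [k [rk yz]]]] := H j r (le_trans rq qp) rj.
exists r'; split; first exact: le_trans rq.
exists k; split=> //; apply: (@forces_eq_trans (y j)) yz; exact: forces_eq_le ay.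
Qed.

(** It is enough to test the listed elements [x i] and [y j], since a condition below [s i] forces
    [x i] into the first name. *)
Lemma forces_eq_ext a b p :
  (forall q c, q <= p -> (q ⊩ (c ∈ a) <-> q ⊩ (c ∈ b))) -> p ⊩ (a ≐ b).
Proof.
case: a b => [A x s] [B y t] H; split=> i q qp qs.
- have : q ⊩ (x i ∈ Name x s).
    move=> r rq; exists r; split=> //; exists i.
    by split; [apply: le_trans qs|apply: forces_eq_refl].
  by move=> /(H _ _ qp)/(_ q (lexx q)).
- have : q ⊩ (y i ∈ Name y t).
    move=> r rq; exists r; split=> //; exists i.
    by split; [apply: le_trans qs|apply: forces_eq_refl].
  move=> /(H _ _ qp)/(_ q (lexx q))[r [rq [j [rj ?]]]].
  by exists r; split=> //; exists j; split=> //; apply: forces_eq_sym.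
Qed.

Definition term_extensional (g : name P -> name P) :=
  forall p a b, p ⊩ (a ≐ b) -> p ⊩ (g a ≐ g b).

(** Bound variables are higher-order, so a formula with a hole is an arbitrary function on names and
    need not respect forced equality. Replacing equals by equals is therefore established formula by
    formula, along the syntax. *)
Definition extensional (φ : name P -> formula (name P)) :=
  forall p a b, p ⊩ (a ≐ b) -> p ⊩ (φ a) -> p ⊩ (φ b).

Lemma term_extensional_id : term_extensional (fun x => x).
Proof. by []. Qed.

Lemma term_extensional_cst c : term_extensional (fun=> c).
Proof. by move=> p a b _; apply: forces_eq_refl. Qed.

Lemma extensional_eq g h : term_extensional g -> term_extensional h ->
  extensional (fun x => FEq (g x) (h x)).
Proof.
move=> Hg Hh p a b ab H; apply: forces_eq_trans (Hh _ _ _ ab).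
exact: forces_eq_trans (forces_eq_sym (Hg _ _ _ ab)) H.
Qed.

Lemma extensional_mem g h : term_extensional g -> term_extensional h ->
  extensional (fun x => FMem (g x) (h x)).
Proof.
move=> Hg Hh p a b ab H; apply: forces_mem_eqr (Hh _ _ _ ab) _.
exact: forces_mem_eql (Hg _ _ _ ab) H.
Qed.

Lemma extensional_not (φ : name P -> formula (name P)) :
  extensional φ -> extensional (fun x => FNot (φ x)).
Proof.
move=> H p a b ab K q qp qb; apply: (K q qp); apply: H qb.
exact/forces_eq_sym/(forces_le qp).
Qed.

Lemma extensional_and (φ ψ : name P -> formula (name P)) :
  extensional φ -> extensional ψ ->
  extensional (fun x => FAnd (φ x) (ψ x)).
Proof.
by move=> H K p a b ab [H1 H2]; split; [apply: H H1|apply: K H2].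
Qed.

Lemma extensional_all (φ : name P -> name P -> formula (name P)) :
  (forall y, extensional (φ^~ y)) -> extensional (fun x => FAll (φ x)).
Proof. by move=> H p a b ab K c; apply: H ab (K c). Qed.

End ForcingRelation.

Ltac extensional :=
  repeat first
    [ apply: extensional_and | apply: extensional_not
    | apply: extensional_all; intro
    | apply: extensional_eq | apply: extensional_mem
    | apply: term_extensional_id | apply: term_extensional_cst ].

(* Moves every forcing hypothesis at [p] down to [q], given [qp : q <= p]. *)
Ltac lower qp :=
  match type of qp with
  | is_true (?q <= ?p) =>
      repeat match goal with
      | H : forces p _ |- _ => apply (forces_le qp) in H
      end
  end.

(** * Names for sets, pairs and functions *)

Section Names.
Context {d : Order.disp_t} {P : porderType d}.
Implicit Types (p q r : P) (a b c x y z : name P) (φ ψ χ : formula (name P)).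

Lemma forces_sub A B p : p ⊩ (zf_sub A B) <->
  forall x q, q <= p -> q ⊩ (x ∈ A) -> q ⊩ (x ∈ B).
Proof. exact: forces_all_imp. Qed.

Lemma forces_nonemptyI a x p : p ⊩ (x ∈ a) -> p ⊩ (zf_nonempty a).
Proof. exact: forces_exI. Qed.

(** Each [x t] is paired with every condition, because [P] need not have a greatest element. The
    shape is that of [check], so the check name of a set is convertible to a [set_name]. *)
Definition set_name (T : Type) (x : T -> name P) : name P :=
  @Name d P (T * P)%type (fun u => x u.1) (fun u => u.2).

Lemma set_nameI T (x : T -> name P) t p : p ⊩ (x t ∈ set_name x).
Proof.
move=> q _; exists q; split=> //; exists (t, q); split=> //.
exact: forces_eq_refl.
Qed.
Arguments set_nameI {T} x t p.

Lemma set_nameP T (x : T -> name P) a p : p ⊩ (a ∈ set_name x) <->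
  forall q, q <= p -> exists2 r, r <= q & exists t, r ⊩ (a ≐ x t).
Proof.
split=> H q qp.
  by have [r [rq [[t s] [_ at_]]]] := H q qp; exists r => //; exists t.
by have [r rq [t at_]] := H q qp; exists r; split=> //; exists (t, r).
Qed.

Lemma set_nameE T (x : T -> name P) a p φ : p ⊩ (a ∈ set_name x) ->
  (forall q t, q <= p -> q ⊩ (a ≐ x t) -> q ⊩ φ) -> p ⊩ φ.
Proof.
move=> /set_nameP H K; apply: forces_dense => q qp.
have [r rq [t ra]] := H q qp; exists r => //; apply: K ra.
exact: le_trans qp.
Qed.

Definition sep_name a (φ : name P -> formula (name P)) : name P :=
  let: Name A x s := a in
  @Name d P {u : A * P | u.2 <= s u.1 /\ u.2 ⊩ (φ (x u.1))}
    (fun u => x (sval u).1) (fun u => (sval u).2).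

(** A member [c] is only forced equal to some listed [x j]; extensionality carries [φ] between the
    two. *)
Lemma sep_nameP a (φ : name P -> formula (name P)) c p : extensional φ ->
  p ⊩ (c ∈ sep_name a φ) <-> p ⊩ (c ∈ a) /\ p ⊩ (φ c).
Proof.
case: a => I x s φe; split=> [H|[H K] q qp].
- split.
    move=> q qp; have [r [rq [[[j t] /= [ts ?]] [/= rt cx]]]] := H q qp.
    by exists r; split=> //; exists j; split=> //; apply: le_trans ts.
  apply: forces_dense => q qp.
  have [r [rq [[[j t] /= [_ xt]] [/= rt cx]]]] := H q qp.
  exists r => //; apply: φe (forces_le rt xt); exact: forces_eq_sym.
- have [r [rq [j [rj cx]]]] := H q qp.
  exists r; split=> //.
  have xr : r ⊩ (φ (x j)) by apply: φe cx (forces_le (le_trans rq qp) K).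
  by exists (exist _ (j, r) (conj rj xr)).
Qed.

Definition upair_name a b : name P :=
  set_name (fun c : bool => if c then a else b).

Lemma upair_nameP a b x p :
  p ⊩ (x ∈ upair_name a b) <-> p ⊩ (x ≐ a ∨ x ≐ b).
Proof.
split=> H.
  by apply: (set_nameE H) => q [] qp xab; [apply: forces_orl|apply: forces_orr].
apply: (forces_orE H) => q qp xab.
  exact/(forces_mem_eql (forces_eq_sym xab))/(set_nameI _ true _).
exact/(forces_mem_eql (forces_eq_sym xab))/(set_nameI _ false _).
Qed.

Lemma upair_namel a b p : p ⊩ (a ∈ upair_name a b).
Proof. exact: (set_nameI _ true _). Qed.

Lemma upair_namer a b p : p ⊩ (b ∈ upair_name a b).
Proof. exact: (set_nameI _ false _). Qed.

Lemma forces_upair a b c p : p ⊩ (zf_upair a b c) <-> p ⊩ (c ≐ upair_name a b).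
Proof.
split=> H.
  apply: forces_eq_ext => q x qp.
  move: H => /forces_all_iff/(_ x q qp) xc.
  by rewrite xc upair_nameP.
apply/forces_all_iff => x q qp; lower qp.
rewrite -upair_nameP; split; first exact: forces_mem_eqr.
exact/forces_mem_eqr/forces_eq_sym.
Qed.

Lemma upair_name_eq a b a' b' p : p ⊩ (a ≐ a') -> p ⊩ (b ≐ b') ->
  p ⊩ (upair_name a b ≐ upair_name a' b').
Proof.
move=> aa bb; apply: forces_eq_ext => q x qp; lower qp.
rewrite !upair_nameP; split=> H; apply: (forces_orE H) => r rq xab; lower rq.
- exact/forces_orl/(forces_eq_trans xab).
- exact/forces_orr/(forces_eq_trans xab).
- exact/forces_orl/(forces_eq_trans xab)/forces_eq_sym.
- exact/forces_orr/(forces_eq_trans xab)/forces_eq_sym.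
Qed.

(** Unordered pairs may collapse: when [a] and [b] both equal [c], the match is settled by which of
    [a] and [b] equals [e], and symmetrically. *)
Lemma upair_name_inj a b c e p : p ⊩ (upair_name a b ≐ upair_name c e) ->
  p ⊩ ((a ≐ c ∧ b ≐ e) ∨ (a ≐ e ∧ b ≐ c)).
Proof.
move=> H; have Hs := forces_eq_sym H.
have /upair_nameP ace : p ⊩ (a ∈ upair_name c e).
  by apply: forces_mem_eqr H _; apply: upair_namel.
have /upair_nameP bce : p ⊩ (b ∈ upair_name c e).
  by apply: forces_mem_eqr H _; apply: upair_namer.
have /upair_nameP cab : p ⊩ (c ∈ upair_name a b).
  by apply: forces_mem_eqr Hs _; apply: upair_namel.
have /upair_nameP eab : p ⊩ (e ∈ upair_name a b).
  by apply: forces_mem_eqr Hs _; apply: upair_namer.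
clear H Hs.
apply: (forces_orE ace) => q qp a1; lower qp;
apply: (forces_orE bce) => r rq b1; lower rq.
- apply: (forces_orE eab) => s sr e1; lower sr.
    by apply: forces_orr; split=> //; apply: forces_eq_sym.
  by apply: forces_orl; split=> //; apply: forces_eq_sym.
- exact: forces_orl.
- exact: forces_orr.
- apply: (forces_orE cab) => s sr e1; lower sr.
    by apply: forces_orl; split=> //; apply: forces_eq_sym.
  by apply: forces_orr; split=> //; apply: forces_eq_sym.
Qed.

Definition pair_name a b : name P := upair_name (upair_name a a) (upair_name a b).

Lemma pair_name_eq a b a' b' p : p ⊩ (a ≐ a') -> p ⊩ (b ≐ b') ->
  p ⊩ (pair_name a b ≐ pair_name a' b').
Proof. by move=> aa bb; do !apply: upair_name_eq. Qed.

Lemma pair_name_inj a b a' b' p : p ⊩ (pair_name a b ≐ pair_name a' b') ->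
  p ⊩ (a ≐ a') /\ p ⊩ (b ≐ b').
Proof.
move=> /upair_name_inj H; apply/forces_and.
apply: (forces_orE H) => q qp /forces_and[/upair_name_inj H1 /upair_name_inj H2].
- apply: (forces_orE H1) => r rq /forces_and[aa _]; lower rq;
  apply: (forces_orE H2) => s sr /forces_and[aa' bb]; lower sr;
  split=> //; apply: forces_eq_trans bb _;
  exact: forces_eq_trans (forces_eq_sym aa) aa'.
- apply: (forces_orE H1) => r rq /forces_and[aa aa']; lower rq;
  apply: (forces_orE H2) => s sr /forces_and[_ bb]; lower sr;
  split=> //; apply: forces_eq_trans bb _.
  + exact: forces_eq_trans (forces_eq_sym aa) aa'.
  + exact: forces_eq_trans (forces_eq_sym aa) aa'.
  + exact: forces_eq_trans (forces_eq_sym aa') aa.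
  + exact: forces_eq_trans (forces_eq_sym aa') aa.
Qed.

Lemma forces_pair a b c p : p ⊩ (zf_pair a b c) <-> p ⊩ (c ≐ pair_name a b).
Proof.
split=> H.
  apply: (forces_exE H) => q x qp K; apply: (forces_exE K) => r y rq.
  move=> /forces_and[/forces_upair H1 /forces_and[/forces_upair H2]].
  move=> /forces_upair H3; apply: forces_eq_trans H3 _.
  exact: upair_name_eq.
apply: (forces_exI (a := upair_name a a)).
apply: (forces_exI (a := upair_name a b)).
by split; [|split]; apply/forces_upair => //; apply: forces_eq_refl.
Qed.

Lemma forces_maps f a b p : p ⊩ (zf_maps f a b) <-> p ⊩ (pair_name a b ∈ f).
Proof.
split=> H.
  apply: (forces_exE H) => q x qp /forces_and[/forces_pair].
  exact: forces_mem_eql.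
apply: (forces_exI (a := pair_name a b)); split=> //.
by apply/forces_pair/forces_eq_refl.
Qed.

Lemma maps_eq f a b a' b' p : p ⊩ (a ≐ a') -> p ⊩ (b ≐ b') ->
  p ⊩ (zf_maps f a b) -> p ⊩ (zf_maps f a' b').
Proof.
move=> aa bb /forces_maps H; apply/forces_maps.
exact: forces_mem_eql (pair_name_eq aa bb) H.
Qed.

Definition graph_name (T : Type) (x y : T -> name P) : name P :=
  set_name (fun t => pair_name (x t) (y t)).

Lemma graph_nameI T (x y : T -> name P) t p :
  p ⊩ (zf_maps (graph_name x y) (x t) (y t)).
Proof. exact/forces_maps/(set_nameI _ t p). Qed.
Arguments graph_nameI {T} x y t p.
Arguments graph_nameI {T} x y t p.

Lemma graph_nameE T (x y : T -> name P) a b p φ :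
  p ⊩ (zf_maps (graph_name x y) a b) ->
  (forall q t, q <= p -> q ⊩ (a ≐ x t) -> q ⊩ (b ≐ y t) -> q ⊩ φ) -> p ⊩ φ.
Proof.
move=> /forces_maps H K; apply: (set_nameE H) => q t qp /pair_name_inj[].
exact: K.
Qed.

Definition distinct_names (T : Type) (x : T -> name P) :=
  forall p s t, p ⊩ (x s ≐ x t) -> s = t.

(** Single-valuedness comes from [distinct_names]: two indices that fit the same argument coincide
    in the ground model, and so do their values. *)
Lemma graph_name_function T (x y : T -> name P) p : distinct_names x ->
  p ⊩ (zf_function (graph_name x y) (set_name x)).
Proof.
move=> xs; split.
  apply/forces_all_imp => c q qp cf.
  apply: (set_nameE cf) => r t rq ct.
  apply: (forces_exI (a := x t)); apply: (forces_exI (a := y t)).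
  by split; [apply: set_nameI|apply/forces_pair].
apply/forces_all_imp => a q qp aA.
apply: (set_nameE aA) => r t rq at_.
apply: (forces_exI (a := y t)); split.
  apply: maps_eq (graph_nameI x y t r); first exact: forces_eq_sym.
  exact: forces_eq_refl.
apply/forces_all_imp => c s sr sc; lower sr.
apply: (graph_nameE sc) => u t' us at' ct'; lower us.
have tt' := xs _ _ _ (forces_eq_trans (forces_eq_sym at_) at').
by rewrite tt'.
Qed.

Lemma graph_name_injection T (x y : T -> name P) B p :
  distinct_names x -> distinct_names y -> (forall t, p ⊩ (y t ∈ B)) ->
  p ⊩ (zf_injection (graph_name x y) (set_name x) B).
Proof.
move=> xs ys yB; split; first exact: graph_name_function.
split.
  move=> a; apply/forces_all_imp => b q qp H.
  apply: (graph_nameE H) => r t rq _ byt.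
  apply: forces_mem_eql (forces_eq_sym byt) _.
  exact: forces_le (le_trans rq qp) (yB t).
move=> a; apply/forces_all => b; apply/forces_all_imp => c q qp /forces_and[H K].
apply: (graph_nameE H) => r t rq ax cy; lower rq.
apply: (graph_nameE K) => s t' sr ax' cy'; lower sr.
have tt' := ys _ _ _ (forces_eq_trans (forces_eq_sym cy) cy').
by rewrite -tt' in ax'; apply: forces_eq_trans (forces_eq_sym ax').
Qed.

End Names.
Arguments set_nameI {d P T} x t p.
Arguments graph_nameI {d P T} x y t p.

(** * Ordinals in the extension *)

Section OrdinalNames.
Context {d : Order.disp_t} {P : porderType d}.
Context {dT : Order.disp_t} {T : orderType dT}.
Hypothesis wfT : well_founded (fun s t : T => s < t).
Implicit Types (p q r : P) (s t u : T) (a b c x y z : name P)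
  (φ : formula (name P)).

(** The von Neumann ordinal of the initial segment below [t], built directly as a name. Over [nat]
    it gives the natural numbers, over [omega1] the countable ordinals of the ground model. *)
Definition ord_name : T -> name P :=
  Fix wfT (fun=> name P)
    (fun t rec => set_name (fun s : {s | s < t} => rec (sval s) (svalP s))).

Lemma ord_nameE t :
  ord_name t = set_name (fun s : {s | s < t} => ord_name (sval s)).
Proof.
rewrite /ord_name Fix_eq // => s f g fg; congr set_name.
by apply: funext => u; apply: fg.
Qed.

Lemma ord_name_ind t a p φ : p ⊩ (a ∈ ord_name t) ->
  (forall q s, q <= p -> s < t -> q ⊩ (a ≐ ord_name s) -> q ⊩ φ) -> p ⊩ φ.
Proof.
rewrite ord_nameE => H K; apply: (set_nameE H) => q [s st] qp; exact: K.
Qed.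

Lemma ord_name_ltI s t p : s < t -> p ⊩ (ord_name s ∈ ord_name t).
Proof.
move=> st; rewrite [ord_name t]ord_nameE.
exact: (set_nameI (fun s : {s | s < t} => ord_name (sval s)) (exist _ s st)).
Qed.

(** Self-membership forces [ord_name t] to equal some smaller [ord_name s] below [p]; as
    [ord_name s] lies in [ord_name t], it then lies in itself, and well-founded induction
    applies. *)
Lemma ord_name_irr t p : ~ p ⊩ (ord_name t ∈ ord_name t).
Proof.
elim: (wfT t) p => {}t _ IH p.
rewrite {2}ord_nameE => /set_nameP/(_ p (lexx p))[r rp [[s st] /= ts]].
apply: (IH s st r); apply: forces_mem_eqr ts _; exact: ord_name_ltI.
Qed.

Lemma ord_name_distinct : distinct_names ord_name.
Proof.
move=> p s t st; case: (ltgtP s t) => // lt; exfalso.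
- apply: (@ord_name_irr s p); apply: forces_mem_eqr (forces_eq_sym st) _.
  exact: ord_name_ltI.
- apply: (@ord_name_irr t p); apply: forces_mem_eqr st _; exact: ord_name_ltI.
Qed.

Lemma ord_name_lt s t p : p ⊩ (ord_name s ∈ ord_name t) -> s < t.
Proof.
rewrite [ord_name t]ord_nameE => /set_nameP/(_ p (lexx p))[r rp [[u ut] /=]].
by move=> /ord_name_distinct ->.
Qed.

Lemma ord_name_ordinal p : p ⊩ (zf_ordinal (set_name ord_name)).
Proof.
have memE q a b s t : q ⊩ (a ≐ ord_name s) -> q ⊩ (b ≐ ord_name t) ->
    q ⊩ (a ∈ b) <-> s < t.
  move=> as_ bt; split=> [H|st].
    apply: (@ord_name_lt _ _ q).
    exact: forces_mem_eqr bt (forces_mem_eql as_ H).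
  apply: forces_mem_eqr (forces_eq_sym bt) _.
  exact: forces_mem_eql (forces_eq_sym as_) (ord_name_ltI _ st).
split.
  apply/forces_all_imp => x q qp xT; apply: (set_nameE xT) => r s rq xs.
  apply/forces_sub => y r' r'r yx; lower r'r.
  apply: (ord_name_ind (forces_mem_eqr xs yx)) => v t vr' ts yt.
  exact: forces_mem_eql (forces_eq_sym yt) (set_nameI ord_name t _).
split.
  apply/forces_all_imp => x q qp xT; apply: (set_nameE xT) => r s rq xs.
  apply/forces_not => v vr xx; lower vr.
  by move: xx; rewrite (memE v x x s s) // ltxx.
split.
  move=> x; apply/forces_all => y; apply/forces_all_imp => z q qp.
  move=> /forces_and[xT /forces_and[yT /forces_and[zT /forces_and[xy yz]]]].
  apply: (set_nameE xT) => r1 s r1q xs; lower r1q.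
  apply: (set_nameE yT) => r2 t r2q yt; lower r2q.
  apply: (set_nameE zT) => r3 u r3q zu; lower r3q.
  move: xy yz; rewrite (memE r3 x y s t) // (memE r3 y z t u) //.
  by rewrite (memE r3 x z s u) //; apply: lt_trans.
split.
  move=> x; apply/forces_all_imp => y q qp /forces_and[xT yT].
  apply: (set_nameE xT) => r1 s r1q xs; lower r1q.
  apply: (set_nameE yT) => r2 t r2q yt; lower r2q.
  case: (ltgtP s t) => [st|ts|st].
  - by apply: forces_orl; apply/(memE r2 x y s t).
  - by apply/forces_orr/forces_orr/(memE r2 y x t s).
  - apply/forces_orr/forces_orl/(forces_eq_trans xs); rewrite st.
    exact: forces_eq_sym.
apply/forces_all_imp => S q qp /forces_and[/forces_sub ST /forces_ex Sne].
apply: forces_dense => r rq.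
have [r1 r1r [x xS]] := Sne r rq.
have [v vr1 [t0 xt0]] :=
  (set_nameP _ _ _).1 (ST x _ (le_trans r1r rq) xS) r1 (lexx r1).
(* The minimum of [S] is found in the ground model: [t] is least among the indices that some
   condition below [r] forces into [S], and [w] witnesses this. Whatever a condition below [w]
   forces into [S] has its index in [A] too, hence is not below [t]. *)
pose A := [set t | exists2 w, w <= r & w ⊩ (ord_name t ∈ S)].
have At0 : A t0.
  exists v; first exact: le_trans r1r.
  by apply: forces_mem_eql xt0 _; apply: forces_le xS.
have [t [w wr tS] tmin] : exists2 t, A t & forall s, A s -> t <= s.
  elim: (wfT t0) At0 {xt0} => {}t0 _ IH At0.
  have [[s As st0]|N] := EM (exists2 s, A s & s < t0); first exact: (IH s).
  exists t0 => // s As; rewrite leNgt; apply/negP => st0.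
  by apply: N; exists s.
exists w => //; apply: (forces_exI (a := ord_name t)); split=> //.
apply/forces_all_imp => y w' w'w yS.
have yT := ST y w' (le_trans w'w (le_trans wr rq)) yS.
apply: (set_nameE yT) => v' s v'w ys; lower v'w.
have : t <= s.
  apply: tmin; exists v'; first exact: le_trans v'w (le_trans w'w wr).
  exact: forces_mem_eql yS.
rewrite le_eqVlt => /predU1P[->|ts].
  exact/forces_orl/forces_eq_sym.
apply/forces_orr/(memE _ _ _ t s) => //; exact: forces_eq_refl.
Qed.

End OrdinalNames.

(** * The ordinal omega and countability in the extension *)

Lemma nat_wf : well_founded (fun m n : nat => m < n).
Proof.
move=> n; have [k] := ubnP n; elim: k n => [|k IH] n; first by rewrite ltn0.
rewrite ltnS => nk; constructor=> m; rewrite ltEnat /= => mn.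
exact: IH (leq_trans mn nk).
Qed.

Section Omega.
Context {d : Order.disp_t} {P : porderType d}.
Implicit Types (p q r : P) (a b c x y z : name P).

Definition nat_name : nat -> name P := ord_name nat_wf.
Definition omega_name : name P := set_name nat_name.

Lemma nat_name0 p x : ~ p ⊩ (x ∈ nat_name 0%N).
Proof.
rewrite /nat_name ord_nameE => /set_nameP/(_ p (lexx p))[r rp [[s s0] _]].
by move: s0; rewrite ltEnat.
Qed.

Lemma nat_nameS p n x :
  p ⊩ (x ∈ nat_name n.+1) <-> p ⊩ (x ∈ nat_name n ∨ x ≐ nat_name n).
Proof.
split=> H.
  apply: (ord_name_ind H) => q m qp; rewrite ltEnat /= ltnS leq_eqVlt.
  move=> /predU1P[->|mn] xm; first exact: forces_orr.
  apply/forces_orl/(forces_mem_eql (forces_eq_sym xm)); exact: ord_name_ltI.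
apply: (forces_orE H) => q qp K.
  apply: (ord_name_ind K) => r m rq mn xm.
  apply/(forces_mem_eql (forces_eq_sym xm))/ord_name_ltI.
  exact: ltn_trans mn (ltnSn n).
exact/(forces_mem_eql (forces_eq_sym K))/ord_name_ltI/ltnSn.
Qed.

Lemma nat_name_succ p n : p ⊩ (zf_succ (nat_name n) (nat_name n.+1)).
Proof. by apply/forces_all_iff => x q qp; apply: nat_nameS. Qed.

Lemma zf_succ_eq a a' b p : p ⊩ (a ≐ a') -> p ⊩ (zf_succ a b) -> p ⊩ (zf_succ a' b).
Proof.
move: a a'; suff: @extensional d P (fun a => zf_succ a b) by apply.
rewrite /zf_succ; extensional.
Qed.

Lemma zf_succ_nat_name n m p : p ⊩ (zf_succ (nat_name n) m) ->
  p ⊩ (m ≐ nat_name n.+1).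
Proof.
move=> /forces_all_iff H; apply: forces_eq_ext => q x qp.
by rewrite H // nat_nameS.
Qed.

Lemma inductive_nat_name p (I : name P) n : p ⊩ (zf_inductive I) ->
  p ⊩ (nat_name n ∈ I).
Proof.
move=> /forces_and[I0 /forces_all_imp IS]; elim: n => [|n IHn].
  apply: (forces_exE I0) => q z qp /forces_and[z0 zI].
  apply: forces_mem_eql zI; apply: forces_eq_ext => r x rq; split.
    move=> xz; exfalso; apply: (z0 r rq); exact: forces_nonemptyI xz.
  by move=> /nat_name0.
apply: (forces_exE (IS _ _ (lexx p) IHn)) => q m qp /forces_and[nm].
by apply: forces_mem_eql; apply: zf_succ_nat_name.
Qed.

Lemma omega_name_inductive p : p ⊩ (zf_inductive omega_name).
Proof.
split.
  apply: (forces_exI (a := nat_name 0)); split; last exact: set_nameI.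
  by apply/forces_not => q qp /forces_ex/(_ q (lexx q))[r rq [x /nat_name0]].
apply/forces_all_imp => x q qp xω.
apply: (set_nameE xω) => r n rq xn.
apply: (forces_exI (a := nat_name n.+1)); split; last exact: set_nameI.
exact: zf_succ_eq (forces_eq_sym xn) (nat_name_succ _ _).
Qed.

Lemma forces_omega_name p : p ⊩ (zf_omega omega_name).
Proof.
split; first exact: omega_name_inductive.
apply/forces_all_imp => J q qp Jind; apply/forces_sub => x r rq xω; lower rq.
apply: (set_nameE xω) => s n sr xn; lower sr.
by apply: forces_mem_eql (forces_eq_sym xn) _; apply: inductive_nat_name.
Qed.

Lemma zf_countable_eq : @extensional d P zf_countable.
Proof.
rewrite /zf_countable /zf_injection /zf_function /zf_maps /zf_pair /zf_upair.
extensional.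
Qed.

(** A ground-model injection into [nat] survives: its graph, transported to canonical names, is an
    injection into omega. *)
Lemma countable_ord_name dT (T : orderType dT)
    (wfT : well_founded (fun s t : T => s < t)) (t : T) p :
  countable [set s | s < t] -> p ⊩ (zf_countable (ord_name wfT t)).
Proof.
move=> /countable_injP[g gi].
apply: (forces_exI (a := omega_name)).
pose y (s : {s | s < t}) : name P := nat_name (g (sval s)).
pose x (s : {s | s < t}) : name P := ord_name wfT (sval s).
apply: (forces_exI (a := graph_name x y)).
split; first exact: forces_omega_name.
rewrite ord_nameE; apply: graph_name_injection.
- by move=> q [u ut] [v vt] /ord_name_distinct /= uv; apply: eq_exist.
- move=> q [u ut] [v vt] /ord_name_distinct /= uv; apply: eq_exist.
  by apply: gi => //; rewrite inE.
- by move=> s; apply: set_nameI.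
Qed.

End Omega.

Lemma check_inj d (P : porderType d) (a b : vset) (p : P) :
  p ⊩ (check P a ≐ check P b) -> vset_eq a b.
Proof.
rewrite forces_eqE; elim: a b p => [A f IH] [B g] p /= [H K]; split=> i.
  have [r [_ [[j t] [_ ij]]]] := H (i, p) p (lexx p) (lexx p).
  by exists j; apply: IH ij.
have [r [_ [[j t] [_ ij]]]] := K (i, p) p (lexx p) (lexx p).
by exists j; apply: IH ij.
Qed.

(** * The countable chain condition and omega_1 *)

(** With [R t q] read as [q] deciding the value [t], this bounds the number of possible values. One
    chosen condition per value gives an injective family whose range is an antichain. *)
Lemma ccc_countable d (P : porderType d) (T : Type) (R : T -> P -> Prop) :
  ccc P ->
  (forall s t q r, R s q -> R t r -> compatible q r -> s = t) ->
  countable [set t | exists q, R t q].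
Proof.
move=> cccP RC; set A := [set t | _].
have [->|/set0P[t0 [q0 _]]] := eqVneq A set0; first exact: countable0.
have [h hR] : {h : T -> P & forall t, A t -> R t (h t)}.
  apply: (@choice _ _ (fun t q => A t -> R t q)) => t.
  have [[q Rq]|NA] := pselect (A t); first by exists q.
  by exists q0 => At; case: (NA At).
have hA : {in A &, injective h}.
  move=> s t /set_mem As /set_mem At st; apply: RC (hR s As) (hR t At) _.
  by exists (h s); rewrite -st.
rewrite -(eq_countable (inj_card_eq hA)); apply: cccP.
move=> _ _ [s As <-] [t At <-] st comp; apply: st.
by rewrite (RC _ _ _ _ (hR s As) (hR t At) comp).
Qed.

Lemma omega1_lt_wf : well_founded (fun a b : omega1 => a < b).
Proof.
move=> a; apply: contrapT => Na.
have [|m Nm mmin] := @omega1_wf [set x | ~ Acc (fun a b => a < b) x].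
  by exists a.
apply: Nm; constructor=> y ym; apply: contrapT => Ny.
by have := mmin _ Ny; rewrite leNgt ym.
Qed.

Lemma omega1_countable_lt (a : omega1) : countable [set x | x < a].
Proof.
apply: (@sub_countable _ _ _ [set x | x <= a]).
  by apply: subset_card_le => x /ltW.
exact: omega1_initial_countable.
Qed.

(** Otherwise countably many initial segments, each countable, would cover [omega1]. *)
Lemma omega1_countable_bounded (A : set omega1) : countable A ->
  exists b, forall a, A a -> a < b.
Proof.
move=> cA; apply: contrapT => N; apply: omega1_uncountable.
have -> : [set: omega1] = \bigcup_(a in A) [set x | x <= a].
  apply/seteqP; split=> // b _; apply: contrapT => Nb; apply: N.
  exists b => a Aa; rewrite ltNge; apply/negP => ba; apply: Nb.
  by exists a.
apply: bigcup_countable => // a _; exact: omega1_initial_countable.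
Qed.

Section Omega1Names.
Context {d : Order.disp_t} {P : porderType d}.
Implicit Types (p q r : P) (x : name P).

(** By induction the ordinal [a] named by [α] is a subset of [κ]. It differs from [κ] because it is
    countable, so [κ] minus [a] has a least element, and that element is [a]. *)
Lemma ord_name_mem_omega1 (κ : name P) p (α : omega1) : p ⊩ (zf_omega1 κ) ->
  p ⊩ (ord_name omega1_lt_wf α ∈ κ).
Proof.
move=> /forces_and[/forces_and[κtr /forces_and[κirr /forces_and[κtrans]]]].
move=> /forces_and[κtot κwf] /forces_and[κunc _].
elim: (omega1_lt_wf α) => {}α _ IH.
set a := ord_name _ α.
pose S := sep_name κ (fun x => ¬ x ∈ a)%zf.
have SP q x : q ⊩ (x ∈ S) <-> q ⊩ (x ∈ κ) /\ q ⊩ (¬ x ∈ a).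
  by apply: sep_nameP; extensional.
have aκ q : q <= p -> q ⊩ (zf_sub a κ).
  move=> qp; apply/forces_sub => x r rq xa.
  apply: (ord_name_ind xa) => v β vr βα xβ.
  apply: forces_mem_eql (forces_eq_sym xβ) _.
  apply: forces_le (IH _ βα); exact: le_trans vr (le_trans rq qp).
apply: (forces_case (φ := zf_nonempty S)) => q qp Sne; lower qp; last first.
  have κa : q ⊩ (κ ≐ a).
    apply: forces_eq_ext => r x rq; split; last first.
      by move=> xa; apply: ((forces_sub _ _ _).1 (aκ q qp)) xa.
    move=> xκ; apply: (forces_case (φ := (x ∈ a)%zf)) => // r' r'r xa; lower r'r.
    exfalso; apply: (Sne r' (le_trans r'r rq)).
    by apply: (forces_nonemptyI (x := x)); apply/SP.
  exfalso; apply: (κunc q (lexx q)).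
  have : q ⊩ (zf_countable a) by exact/countable_ord_name/omega1_countable_lt.
  exact: zf_countable_eq (forces_eq_sym κa).
have Sκ : q ⊩ (zf_sub S κ) by apply/forces_sub => x r rq /SP[].
have := (forces_all_imp _ _ _).1 κwf S q (lexx q) (conj Sκ Sne).
move=> H; apply: (forces_exE H) => r m rq /forces_and[/SP[mκ ma] /forces_all_imp mS].
lower rq.
(* Minimality of [m] in [S] puts every element of [m] into [a]. Conversely, for [x] in [a], either
   alternative to membership of [x] in [m] in the trichotomy would put [m] into [a]. *)
suff ma' : r ⊩ (m ≐ a) by exact: forces_mem_eql mκ.
apply: forces_eq_ext => v x vr; lower vr; split=> [xm|xa].
  have xκ : v ⊩ (x ∈ κ).
    have /forces_sub := (forces_all_imp _ _ _).1 κtr m v (lexx v) mκ.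
    exact.
  apply: (forces_case (φ := (x ∈ a)%zf)) => // w wv xa; lower wv.
  have mm : w ⊩ (m ∈ m).
    have xS : w ⊩ (x ∈ S) by apply/SP.
    apply: (forces_orE (mS x w (le_trans wv vr) xS)) => u uw; lower uw.
      by move=> mx; apply: forces_mem_eql (forces_eq_sym mx) xm.
    move=> mx.
    have H1 := (forces_all _ _).1 ((forces_all _ _).1 κtrans m) x.
    by apply: ((forces_all_imp _ _ _).1 H1 m u (lexx u)).
  exfalso; exact: ((forces_all_imp _ _ _).1 κirr m w (lexx w) mκ w (lexx w) mm).
apply: (ord_name_ind xa) => w β wv βα xβ; lower wv.
have xκ : w ⊩ (x ∈ κ).
  apply: forces_mem_eql (forces_eq_sym xβ) _.
  exact: forces_le (le_trans wv (le_trans vr (le_trans rq qp))) (IH _ βα).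
have K := (forces_all_imp _ _ _).1
  ((forces_all _ _).1 κtot x) m w (lexx w) (conj xκ mκ).
 apply: (forces_orE K) => u uw //; lower uw.
move=> {}K; apply: (forces_orE K) => t tu mx; lower tu;
  apply: (@forces_absurd _ _ _ (m ∈ a)%zf) => //.
  exact: forces_mem_eql xa.
apply: (ord_name_ind (forces_mem_eqr xβ mx)) => t' γ t't γβ mγ.
apply: forces_mem_eql (forces_eq_sym mγ) _; apply: ord_name_ltI.
exact: lt_trans βα.
Qed.

(** Suppose [v] forces an injection into omega. For each [n], the chain condition leaves countably
    many [α] that an extension of [v] can send to [n]; every [α] is sent somewhere, so [omega1]
    would be countable. *)
Lemma ccc_omega1_name p : ccc P ->
  p ⊩ (zf_omega1 (set_name (@ord_name d P _ _ omega1_lt_wf))).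
Proof.
move=> cccP; split; first exact: ord_name_ordinal.
split; last first.
  apply/forces_all_imp => a q qp aκ; apply: (set_nameE aκ) => r α rq aα.
  have : r ⊩ (zf_countable (ord_name omega1_lt_wf α)).
    exact/countable_ord_name/omega1_countable_lt.
  exact: zf_countable_eq (forces_eq_sym aα).
apply/forces_not => q qp /forces_ex/(_ q (lexx q))[r rq [w]].
move=> /forces_ex/(_ r (lexx r))[v vr [f /forces_and[/forces_and[_ wmin]]]].
move: wmin => /forces_all_imp wmin.
move=> /forces_and[/forces_and[_ /forces_all_imp fT] /forces_and[fw finj]].
(* The name [w] is merely forced to be omega; its leastness places its elements in [omega_name], so
   that values can be decided as numerals. *)
have {wmin}/forces_sub wω := wmin _ v (lexx v) (omega_name_inductive v).
pose R n α u := u <= v /\ u ⊩ (zf_maps f (ord_name omega1_lt_wf α) (nat_name n)).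
apply: omega1_uncountable.
have -> : [set: omega1] = \bigcup_n [set α | exists u, R n α u].
  apply/seteqP; split=> // α _.
  have /forces_ex/(_ v (lexx v))[u uv [b /forces_and[fb _]]] :=
    fT _ v (lexx v) (set_nameI (ord_name omega1_lt_wf) α v).
  have bw : u ⊩ (b ∈ w).
    have H := (forces_all _ _).1 fw (ord_name omega1_lt_wf α).
    exact: ((forces_all_imp _ _ _).1 H).
  have /set_nameP/(_ u (lexx u))[t tu [n bn]] := wω b u uv bw.
  exists n => //; exists t; split; first exact: le_trans uv.
  lower tu; apply: maps_eq bn fb; exact: forces_eq_refl.
apply: bigcup_countable => // n _; apply: ccc_countable => //.
move=> α β t u [tv fα] [uv fβ] [o [ot ou]]; lower ot; lower ou.
apply: (@ord_name_distinct _ _ _ _ omega1_lt_wf o).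
have := (forces_all_imp _ _ _).1 ((forces_all _ _).1
  ((forces_all _ _).1 finj _) _) _ o (le_trans ot tv) (conj fα fβ).
exact.
Qed.

End Omega1Names.

(** * Ground-model spaces in the extension *)

Section Spaces.
Context {d : Order.disp_t} {P : porderType d} {X : topologicalType} (e : X -> vset).
Implicit Types (p q r : P) (a : name P) (φ : formula (name P)).

Local Notation points A := (check P (vset_image e A)).

Lemma check_imageI (A : set X) x p : A x -> p ⊩ (check P (e x) ∈ points A).
Proof.
move=> Ax.
exact: (set_nameI (fun x : {x | A x} => check P (e (sval x))) (exist _ x Ax)).
Qed.
Arguments check_imageI {A x} p _.

Lemma check_imageP (A : set X) a p : p ⊩ (a ∈ points A) ->
  exists2 r, r <= p & exists2 x, A x & r ⊩ (a ≐ check P (e x)).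
Proof.
move=> /(_ p (lexx p))[r [rp [[[x Ax] s] [_ ax]]]].
by exists r => //; exists x.
Qed.

Lemma check_image_ind (A : set X) a p φ : p ⊩ (a ∈ points A) ->
  (forall q x, q <= p -> A x -> q ⊩ (a ≐ check P (e x)) -> q ⊩ φ) -> p ⊩ φ.
Proof.
move=> H K; apply: forces_dense => q qp; lower qp.
have [r rq [x Ax ax]] := check_imageP H; exists r => //.
by apply: K ax => //; apply: le_trans qp.
Qed.

Lemma check_image_sub (A B : set X) p : A `<=` B ->
  p ⊩ (zf_sub (points A) (points B)).
Proof.
move=> AB; apply/forces_sub => a q qp aA.
apply: (check_image_ind aA) => r x rq /AB Bx ax.
exact: forces_mem_eql (forces_eq_sym ax) (check_imageI _ Bx).
Qed.

Lemma check_open (U : set X) p : open U ->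
  p ⊩ (zf_open (points setT) (check P (vset_topology e)) (points U)).
Proof.
move=> Uo; split; first exact: check_image_sub.
apply/forces_all_imp => x q qp xU; apply: (forces_exI (a := points U)).
split; last by split => //; apply: check_image_sub.
exact: (set_nameI (fun U : {U : set X | open U} => points (sval U)) (exist _ U Uo)).
Qed.

Lemma check_topology_ind a p φ : p ⊩ (a ∈ check P (vset_topology e)) ->
  (forall q U, q <= p -> open U -> q ⊩ (a ≐ points U) -> q ⊩ φ) -> p ⊩ φ.
Proof.
move=> H K; apply: forces_dense => q qp.
have [r [rq [[[U Uo] s] [_ aU]]]] := H q qp.
by exists r => //; apply: K aU => //; apply: le_trans qp.
Qed.

Lemma ccc_resolvable_monotone p : ccc P ->
  p ⊩ (zf_omega1_resolvable (points setT) (check P (vset_topology e))) ->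
  monotonically_resolvable omega1 X.
Proof.
move=> cccP /forces_ex/(_ p (lexx p))[p1 _ [κ /forces_and[κ1]]].
move=> /forces_ex/(_ p1 (lexx p1))[{}p pp1 [D]] /forces_and[/forces_and[_ Dfun]].
move=> /forces_and[Ddense /forces_and[_ Ddisj]]; lower pp1.
pose o α := @ord_name _ P _ _ omega1_lt_wf α.
pose R x α q :=
  q <= p /\ q ⊩ (∃ S, zf_maps D (o α) S ∧ check P (e x) ∈ S).
(* A common extension of conditions for [α] and [β] forces [x] into both pieces, and disjointness
   then identifies the two indices. *)
have Rcountable x : countable [set α | exists q, R x α q].
  apply: ccc_countable => // α β q r [qp qα] [rp rβ] [s [sq sr]].
  have sp := le_trans sq qp; lower sq; lower sr.
  have /forces_ex/(_ s (lexx s))[t ts [S /forces_and[αS xS]]] := qα.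
  lower ts.
  have /forces_ex/(_ t (lexx t))[u ut [S' /forces_and[βS' xS']]] := rβ.
  lower ut.
  apply: (@ord_name_distinct _ _ _ _ omega1_lt_wf u).
  have H1 := (forces_all _ _).1 Ddisj (o α).
  have H2 := (forces_all _ _).1 H1 (o β).
  have H3 := (forces_all _ _).1 H2 S.
  have H4 := (forces_all _ _).1 H3 S'.
  apply: ((forces_all_imp _ _ _).1 H4 (check P (e x))).
    exact: le_trans ut (le_trans ts sp).
  by split.
have [f fR] : {f : X -> omega1 & forall x α, (exists q, R x α q) -> α < f x}.
  apply: (@choice _ _ (fun x b => forall α, (exists q, R x α q) -> α < b)) => x.
  by have [b Hb] := omega1_countable_bounded (Rcountable x); exists b => α /Hb.
exists f => α O [y Oy] Oo.
(* The piece of index [α] exists because [κ], whatever name it is, contains all ground-model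
   countable ordinals. *)
have ακ := ord_name_mem_omega1 α κ1.
have /forces_ex/(_ p (lexx p))[q qp [S /forces_and[αS _]]] :=
  (forces_all_imp _ _ _).1 Dfun _ p (lexx p) ακ.
have H1 := (forces_all _ _).1 Ddense (o α).
have /forces_and[_ Sdense] := (forces_all_imp _ _ _).1 H1 S q qp αS.
have Olarge : q ⊩ (zf_open (points setT) (check P (vset_topology e)) (points O)
    ∧ zf_nonempty (points O)).
  split; first exact: check_open.
  exact: forces_nonemptyI (check_imageI _ Oy).
have /forces_ex/(_ q (lexx q))[r rq [x /forces_and[xO xS]]] :=
  (forces_all_imp _ _ _).1 Sdense _ q (lexx q) Olarge.
have [s sr [u Ou xu]] := check_imageP xO.
exists u; split=> //=; apply/ltW/fR; exists s; split.
  exact: le_trans sr (le_trans rq qp).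
lower rq; lower sr.
apply: (forces_exI (a := S)); split=> //.
exact: forces_mem_eql xS.
Qed.

(** * Partitions in the extension from ground-model relations *)

Section Piece.
Variable (D : X -> P -> Prop).

Definition subspace_name : name P :=
  @Name d P {u : X * P | D u.1 u.2} (fun u => check P (e (sval u).1))
    (fun u => (sval u).2).

Hypothesis D_le : forall x p q, q <= p -> D x p -> D x q.

Lemma subspace_nameI x p : D x p -> p ⊩ (check P (e x) ∈ subspace_name).
Proof.
move=> xp q qp; exists q; split=> //; exists (exist _ (x, p) xp); split=> //.
exact: forces_eq_refl.
Qed.

Lemma subspace_name_ind a p φ : p ⊩ (a ∈ subspace_name) ->
  (forall q x, q <= p -> D x q -> q ⊩ (a ≐ check P (e x)) -> q ⊩ φ) -> p ⊩ φ.
Proof.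
move=> H K; apply: forces_dense => q qp.
have [r [rq [[[x s] /= xs] [/= rs ax]]]] := H q qp.
exists r => //; apply: (K r x) => //; first exact: le_trans qp.
exact: D_le xs.
Qed.

End Piece.

(** Here [D α x p] means that [p] puts [x] into piece [α]. The last three hypotheses on [D] make the
    pieces disjoint, covering and dense, in this order; the chain condition makes the index set the
    omega_1 of the extension. *)
Lemma generic_resolvable (D : omega1 -> X -> P -> Prop) :
  ccc P -> vset_coding e ->
  (forall α x p q, q <= p -> D α x p -> D α x q) ->
  (forall α β x p, D α x p -> D β x p -> α = β) ->
  (forall x p, exists2 q, q <= p & exists α, D α x q) ->
  (forall α U p, open U -> U !=set0 ->
     exists2 q, q <= p & exists2 x, U x & D α x q) ->
  forces_omega1_resolvable P e.
Proof.
move=> cccP e_coding D_le D_fun D_total D_generic p.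
pose o α := @ord_name _ P _ _ omega1_lt_wf α.
pose piece α := subspace_name (D α).
apply: (forces_exI (a := set_name o)); split; first exact: ccc_omega1_name.
apply: (forces_exI (a := graph_name o piece)); split.
  by apply: graph_name_function; apply: ord_name_distinct.
split.
  move=> a; apply/forces_all_imp => S q qp aS.
  apply: (graph_nameE aS) => r α rq _ Sα.
  have : r ⊩ (zf_dense (points setT) (check P (vset_topology e)) (piece α)).
    split.
      apply/forces_sub => x s sr xα.
      apply: (subspace_name_ind _ xα); first exact: D_le.
      move=> t y ts _ xy.
      by apply: forces_mem_eql (forces_eq_sym xy) _; apply: check_imageI.
    apply/forces_all_imp => O s sr /forces_and[/forces_and[_ Oopen] One].
    apply: (forces_exE One) => t y ts yO; lower ts.
    have H := (forces_all_imp _ _ _).1 Oopen y t (lexx t) yO.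
    apply: (forces_exE H) => u U ut /forces_and[Uτ /forces_and[yU UO]].
    (* An open set of the extension contains a ground-model open [V], nonempty because [y] is forced
       into it. Genericity is applied to [V], and the point it yields may differ from [y]. *)
    apply: (check_topology_ind Uτ) => v V vu Vopen UV; lower vu.
    have yV := forces_mem_eqr UV yU.
    apply: (check_image_ind yV) => w y' wv Vy' _; lower wv.
    apply: forces_dense => w' w'w; lower w'w.
    have [w'' w''w' [x Vx Dx]] := D_generic α V w' Vopen (ex_intro _ _ Vy').
    exists w'' => //; lower w''w'.
    apply: (forces_exI (a := check P (e x))); split.
      have /forces_sub := UO; apply; first exact: lexx.
      exact: forces_mem_eqr (forces_eq_sym UV) (check_imageI _ Vx).
    exact: subspace_nameI.
  move: (forces_eq_sym Sα); move: (piece α) S {aS Sα}.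
  set τ := check P (vset_topology e); set Y := points setT.
  suff: @extensional d P (zf_dense Y τ) by apply.
  rewrite /zf_dense /zf_sub /zf_open /zf_nonempty; extensional.
split.
  apply/forces_all_imp => a q qp aX.
  apply: (check_image_ind aX) => r x rq _ ax.
  apply: forces_dense => s sr; have [t ts [α xα]] := D_total x s.
  exists t => //; lower sr; lower ts.
  apply: (forces_exI (a := o α)); apply: (forces_exI (a := piece α)).
  split; first exact: graph_nameI.
  exact: forces_mem_eql (forces_eq_sym ax) (subspace_nameI xα).
move=> a; apply/forces_all => b; apply/forces_all => S; apply/forces_all => S'.
apply/forces_all_imp => x q qp.
move=> /forces_and[aS /forces_and[bS' /forces_and[xS xS']]].
apply: (graph_nameE aS) => r α rq aα Sα; lower rq.
apply: (graph_nameE bS') => s β sr bβ S'β; lower sr.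
have xα := forces_mem_eqr Sα xS; have xβ := forces_mem_eqr S'β xS'.
apply: (subspace_name_ind _ xα); first exact: D_le.
move=> t y ts yα xy; lower ts.
apply: (subspace_name_ind _ xβ); first exact: D_le.
move=> u z ut zβ xz; lower ut.
(* A point forced into two pieces comes from one ground-model point, by the injectivity of the
   coding. *)
have yz : y = z.
  by apply/e_coding/(check_inj (p := u))/(forces_eq_trans (forces_eq_sym xy)).
have zα : D α z u by rewrite -yz; apply: D_le yα.
have αβ := D_fun _ _ _ _ zα zβ.
by rewrite αβ in aα; apply/(forces_eq_trans aα)/forces_eq_sym.
Qed.

End Spaces.

(** * Cohen forcing *)

Section FiniteFunctions.
Context {I J : choiceType}.
Implicit Types (p q r s : Fn I J) (A : set (Fn I J)) (B : set I).

Lemma Fn_leP p q : p <= q <->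
  forall i j, q.[? i]%fmap = Some j -> p.[? i]%fmap = Some j.
Proof. by split=> [/asboolP|H]; last exact/asboolP. Qed.

Lemma Fn_compatibleP p q : compatible p q <->
  forall i j k, p.[? i]%fmap = Some j -> q.[? i]%fmap = Some k -> j = k.
Proof.
split=> [[r [/Fn_leP rp /Fn_leP rq]] i j k /rp pi /rq|H].
  by rewrite pi => -[].
exists (p + q)%fset; split; apply/Fn_leP => i j; rewrite fnd_cat.
  case: ifPn => // iq pi; have [k qi] : exists k, q.[? i]%fmap = Some k.
    by exists q.[iq]%fmap; apply: in_fnd.
  by rewrite qi (H i j k).
case: ifPn => // iq; by rewrite not_fnd.
Qed.

Definition Fn_on B : set (Fn I J) := [set s | forall i, i \in domf s -> B i].

End FiniteFunctions.

(** A finite function is coded by the list of its coded arguments and values. Decoding uses only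
    membership in the list, so the enumeration order of the domain does not matter. *)
Lemma Fn_on_countable (I : choiceType) (J : countType) (B : set I) :
  countable B -> countable (@Fn_on I J B).
Proof.
move=> /countable_injP[h hB].
pose code (s : Fn I J) := [seq (h i, s.[? i]%fmap) | i <- domf s].
have codeE s t : Fn_on B s -> Fn_on B t -> code s = code t -> t <= s.
  move=> sB tB st; apply/Fn_leP => i j si.
  have iS : i \in domf s by apply: contraT => /not_fnd; rewrite si.
  have : (h i, s.[? i]%fmap) \in code t by rewrite -st; apply/mapP; exists i.
  move=> /mapP[k kt [hik sk]].
  have ik : i = k by apply: hB => //; rewrite inE; [apply: sB|apply: tB].
  by rewrite ik -sk.
apply/countable_injP; exists (choice.pickle \o code) => s t /set_mem sB /set_mem tB.
move=> /(pcan_inj choice.pickleK) st; apply/eqP; rewrite eq_le.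
by rewrite !codeE.
Qed.

(* Choose [g s] in the antichain [A], compatible with [s] whenever possible, and
   let [S] be a countable set such that [g] maps the finite functions on [S] to
   finite functions on [S]. For [a] in [A], [g (a|S)] is defined on [S] and
   compatible with [a|S], hence compatible with [a], hence equal to [a]. *)
Lemma Fn_ccc (I : choiceType) (J : countType) : ccc (Fn I J).
Proof.
move=> A Aanti.
have [g gP] : {g : Fn I J -> Fn I J & forall s,
    (exists2 a, A a & compatible a s) -> A (g s) /\ compatible (g s) s}.
  apply: (@choice _ _ (fun s t =>
    (exists2 a, A a & compatible a s) -> A t /\ compatible t s)) => s.
  have [[a Aa as_]|N] := pselect (exists2 a, A a & compatible a s).
    by exists a.
  by exists s => /N.
pose next B := (B `|` \bigcup_(s in @Fn_on I J B) [set` domf (g s)])%classic.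
pose S n := iter n next set0.
have Scount n : countable (S n).
  elim: n => [|n IHn]; first exact: countable0.
  have -> : S n.+1 =
    (S n `|` \bigcup_(s in @Fn_on I J (S n)) [set` domf (g s)])%classic by [].
  rewrite -bigcup2E; apply: bigcup_countable => [|[|[|k]] _ //=].
    exact: countableP.
  apply: bigcup_countable; first exact: Fn_on_countable.
  by move=> s _; apply: countable_fset.
have Smono m n : (m <= n)%N -> S m `<=` S n.
  elim: n => [|n IHn]; first by rewrite leqn0 => /eqP->.
  rewrite leq_eqVlt => /predU1P[->//|]; rewrite ltnS => /IHn mn.
  by move=> i /mn; left.
pose T := \bigcup_n S n.
have Tcount : countable T by apply: bigcup_countable => //; exact: countableP.
(* A finite domain inside [T] already lies in one stage [S n], so the next stage contains the domain
   of the associated [g s]. *)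
have finT (s : seq I) : (forall i, i \in s -> T i) ->
    exists n, forall i, i \in s -> S n i.
  elim: s => [|i s IHs] sT; first by exists 0%N.
  have [|n sn] := IHs; first by move=> k ks; apply: sT; rewrite inE ks orbT.
  have [m _ im] : T i by apply: sT; rewrite inE eqxx.
  exists (maxn m n) => k; rewrite inE => /predU1P[->|/sn].
    exact: Smono (leq_maxl _ _) _ im.
  exact: Smono (leq_maxr _ _) _.
suff AT : A `<=` g @` Fn_on T.
  apply: (sub_countable (subset_card_le AT)).
  apply: sub_countable (card_image_le _ _) _; exact: Fn_on_countable.
move=> a Aa.
pose s : Fn I J := filterf a (fun i => `[< T i >]).
have sE i : s.[? i]%fmap = if `[< T i >] then a.[? i]%fmap else None.
  exact: fnd_filterf.
have as_ : a <= s by apply/Fn_leP => i j; rewrite sE; case: ifP.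
have sT : Fn_on T s by move=> i; rewrite mem_filterf => /andP[_ /asboolP].
have [|Ags gss] := gP s; first by exists a => //; exists a.
exists s => //; apply: contrapT => gsa; apply: (Aanti (g s) a Ags Aa gsa).
apply/Fn_compatibleP => i j k gi ai.
have [n sn] := finT _ sT.
have Ti : T i.
  exists n.+1 => //; right; exists s => //=.
  by rewrite -fndSome gi.
move/Fn_compatibleP: gss => /(_ i j k gi); apply.
by rewrite sE; case: asboolP.
Qed.

(** * Coding indices by Cohen bits *)

Section CohenPartition.
Variable nxt : omega1 -> omega1.
Hypothesis lt_nxt : forall a, a < nxt a.

Local Notation Cohen := (Fn omega1 bool).

(** A unary code for [n] along the orbit of [a] under [nxt], so that a finite condition can decide
    it. *)
Definition bits (q : Cohen) (a : omega1) (n : nat) :=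
  (forall i, (i < n)%N -> q.[? iter i nxt a]%fmap = Some false) /\
  q.[? iter n nxt a]%fmap = Some true.

Lemma bits_le p q a n : q <= p -> bits p a n -> bits q a n.
Proof. by move=> /Fn_leP qp [H1 H2]; split=> [i /H1|]; apply: qp. Qed.

Lemma bits_inj q a m n : bits q a m -> bits q a n -> m = n.
Proof.
move=> [m0 m1] [n0 n1]; case: (ltngtP m n) => // mn.
  by move: m1; rewrite n0.
by move: n1; rewrite m0.
Qed.

(** The induction sets the bit at [a] and restarts at [nxt a]; as [a < nxt a], everything from there
    on is still undetermined. *)
Lemma bits_exists n (p : Cohen) a : (forall b, a <= b -> b \notin domf p) ->
  exists2 q, q <= p & bits q a n.
Proof.
have set_le (p' : Cohen) b c : b \notin domf p' -> (p'.[b <- c]%fmap : Cohen) <= p'.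
  move=> bp; apply/Fn_leP => i j pij; rewrite fnd_set; case: eqP => // ib.
  by move: bp; rewrite -ib -fndSome pij.
elim: n p a => [|n IHn] p a pa.
  exists (p.[a <- true]%fmap : Cohen); first by apply: set_le; apply: pa.
  by split=> //=; rewrite fnd_set eqxx.
have [|q qp [q0 q1]] := IHn (p.[a <- false]%fmap : Cohen) (nxt a).
  move=> b ab; have {}ab := lt_le_trans (lt_nxt a) ab.
  by rewrite dom_setf !inE negb_or gt_eqF //= pa // ltW.
exists q; first by apply: le_trans qp _; apply: set_le; apply: pa.
split=> [[_|i]|]; rewrite ?iterSr //; last exact: q0.
by move/Fn_leP: qp; apply; rewrite /= fnd_set eqxx.
Qed.

End CohenPartition.

(** Covering the initial segment is enough: repeated values and values above [a] do no harm, since a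
    condition determines the place [n] and hence the index. *)
Lemma omega1_enumeration (a : omega1) :
  exists h : nat -> omega1, forall b, b <= a -> exists n, h n = b.
Proof.
have /countable_injP[g gi] := omega1_initial_countable a.
have [h hP] : {h : nat -> omega1 & forall n b, b <= a -> g b = n -> h n = b}.
  apply: (@choice _ _ (fun n c => forall b, b <= a -> g b = n -> c = b)) => n.
  have [[c [ca gc]]|N] := pselect (exists c, c <= a /\ g c = n).
    by exists c => b ba gb; apply: gi; rewrite ?inE // gc.
  by exists a => b ba gb; case: N; exists b.
by exists h => b ba; exists (g b); apply: hP.
Qed.

(* The generic function [c] gives [x] the index [h (f x) n] where [n] is the first
   place with [c (nxt^n (f x)) = 1]. The bits from [f x] on are undetermined by
   [p] as soon as [f x] exceeds the domain of [p]. Points that can never get an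
   index below [p] are put in the piece of index [f x]. *)
Lemma monotone_Cohen_resolvable (X : topologicalType) (e : X -> vset) :
  vset_coding e -> monotonically_resolvable omega1 X ->
  forces_omega1_resolvable (Fn omega1 bool) e.
Proof.
move=> e_coding [f f_dense].
have [nxt lt_nxt] : {nxt : omega1 -> omega1 & forall a, a < nxt a}.
  apply: (@choice _ _ (fun a b => a < b)) => a.
  have [b Hb] := omega1_countable_bounded (countable1 a).
  by exists b; apply: Hb.
have [h hP] := choice omega1_enumeration.
pose index α x q := exists2 n, bits nxt q (f x) n & h (f x) n = α.
pose D α x q := index α x q \/
  (α = f x /\ forall r β, r <= q -> ~ index β x r).
have index_le α x p q : q <= p -> index α x p -> index α x q.
  by move=> qp [n /(bits_le qp) ? ?]; exists n.
apply: (generic_resolvable (D := D)) => //.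
- exact: Fn_ccc.
- move=> α x p q qp [|[-> H]]; first by left; apply: index_le qp _.
  by right; split=> // r β rq; apply: H; apply: le_trans qp.
- move=> α β x p [[n pn <-]|[-> H]] [[m pm <-]|[-> K]] //.
  + by rewrite (bits_inj pn pm).
  + by case: (K p (h (f x) n) (lexx p)); exists n.
  + by case: (H p (h (f x) m) (lexx p)); exists m.
- move=> x p.
  have [[q qp [α xα]]|N] :=
      pselect (exists2 q, q <= p & exists α, index α x q).
    by exists q => //; exists α; left.
  exists p => //; exists (f x); right; split=> // r β rp xβ.
  by apply: N; exists r => //; exists β.
- move=> α U p Uo Une.
  have [b pb] := omega1_countable_bounded (countable_fset (domf p)).
  (* The bound [α <= f x] makes [α] appear in the enumeration [h (f x)], and [b <= f x] leaves all
     places from [f x] on outside the domain of [p]. *)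
  have [x [Ux /= bx]] := f_dense (Order.max α b) U Une Uo.
  move: bx; rewrite ge_max => /andP[αx bx].
  have [n hn] := hP (f x) α αx.
  have [|q qp xq] := @bits_exists nxt lt_nxt n p (f x).
    move=> c xc; apply/negP => /pb; apply/negP; rewrite -leNgt.
    exact: le_trans xc.
  by exists q => //; exists x => //; left; exists n.
Qed.

Theorem theorem1p2 (X : topologicalType) (X_T1 : accessible_space X)
    (e : X -> vset) (e_coding : vset_coding e) :
  ((exists (d : Order.disp_t) (P : porderType d),
      inhabited P /\ ccc P /\ forces_omega1_resolvable P e)
   <-> monotonically_resolvable omega1 X) /\
  (monotonically_resolvable omega1 X
   <-> forces_omega1_resolvable (Fn omega1 bool) e).
Proof.
have inhFn : inhabited (Fn omega1 bool) by split; exact: fmap0.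
have cccFn : ccc (Fn omega1 bool) := @Fn_ccc omega1 bool.
(* An actual condition is needed to start from, since over an empty poset every formula is vacuously
   forced. *)
have mono d (P : porderType d) : inhabited P -> ccc P ->
    forces_omega1_resolvable P e -> monotonically_resolvable omega1 X.
  by move=> [p] cccP /(_ p); apply: ccc_resolvable_monotone.
split; split.
- by move=> [d [P [inhP [cccP]]]]; apply: mono.
- move=> Xmono; exists Fn_display, (Fn omega1 bool); split=> //; split=> //.
  exact: monotone_Cohen_resolvable.
- exact: monotone_Cohen_resolvable.
- exact: mono.
Qed.
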